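(* For every integer $h\ge 0$, $f_{\leq h}^1=f_{\leq h}^0=1$, and for all integers $n\geq 2$ and $h\geq 0$, $$f_{\leq h}^n=(h+3)^{-1}\sum_{1\leq j\leq \frac{h+2}{2}}4^{n+1}\sin^2\left(\frac{j\pi}{h+3}\right)\cos^{2n}\left(\frac{j\pi}{h+3}\right).$$
   Context: All posets are finite. A semiorder is a poset with no induced subposet isomorphic to $\mathbf{2}+\mathbf{2}$ (disjoint union of two 2-element chains with no other comparabilities) or $\mathbf{3}+\mathbf{1}$ (disjoint union of a 3-element chain and a single incomparable element). Its length is the length of a longest chain (a chain with $\ell+1$ elements has length $\ell$; the empty poset counts as having length at most $h$ for every $h\ge 0$). For $n\ge 0$, $f_{\leq h}^n$ denotes the number of nonisomorphic unlabeled semiorders with $n$ elements and length at most $h$. The sum is over integers $j$ with $1\le j\le (h+2)/2$. *)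

(* Defs.v *)
From mathcomp Require Import all_boot all_order all_algebra.
From mathcomp Require Import all_classical all_reals all_analysis.

Set Implicit Arguments.
Unset Strict Implicit.
Unset Printing Implicit Defensive.

Definition is_poset (T : Type) (le : rel T) : Prop :=
  [/\ reflexive le, antisymmetric le & transitive le].

(* U is isomorphic to an induced subposet of T. *)
Definition embeds (U T : Type) (leU : rel U) (leT : rel T) : Prop :=
  exists2 f : U -> T, injective f & {mono f : x y / leU x y >-> leT x y}.

Definition isomorphic (U T : Type) (leU : rel U) (leT : rel T) : Prop :=
  exists2 f : U -> T, bijective f & {mono f : x y / leU x y >-> leT x y}.

Definition chain_le (k : nat) : rel 'I_k := fun i j => (i <= j)%N.

(* Disjoint union of posets, with no comparabilities across the summands. *)
Definition sum_le (A B : Type) (leA : rel A) (leB : rel B) : rel (A + B) :=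
  fun u v => match u, v with
  | inl a, inl a' => leA a a'
  | inr b, inr b' => leB b b'
  | _, _ => false
  end.

Definition is_semiorder (T : Type) (le : rel T) : Prop :=
  [/\ is_poset le,
      ~ embeds (sum_le (@chain_le 2) (@chain_le 2)) le
    & ~ embeds (sum_le (@chain_le 3) (@chain_le 1)) le].

(* The number of elements of a longest chain, minus one. The truncated
   predecessor gives the empty poset length 0, so that it has length at most h
   for every h. *)
Definition poset_length (T : finType) (le : rel T) : nat :=
  (\max_(C : {set T} | `[< {in C &, total le} >]) #|C|).-1.

Definition rel_of (T : finType) (G : {set T * T}) : rel T :=
  fun x y => (x, y) \in G.

(* Orders on the fixed carrier 'I_n, each given by its graph. *)
Definition semiorders (h n : nat) : {set {set 'I_n * 'I_n}} :=
  [set G : {set 'I_n * 'I_n} |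
    `[< is_semiorder (rel_of G) >] && (poset_length (rel_of G) <= h)%N].

(* f_{<= h}^n: the number of isomorphism classes of such orders. *)
Definition num_semiorders (h n : nat) : nat :=
  #|equivalence_partition
      (fun G H : {set 'I_n * 'I_n} => `[< isomorphic (rel_of G) (rel_of H) >])
      (semiorders h n)|.

(* Main.v *)
Require Import Defs.
From mathcomp Require Import all_boot all_order all_algebra.
From mathcomp Require Import all_classical all_reals all_analysis.
From mathcomp Require Import zify ring.
Import Order.TTheory GRing.Theory Num.Theory.

Set Implicit Arguments.
Unset Strict Implicit.
Unset Printing Implicit Defensive.

(* A semiorder on n elements is determined up to isomorphism by the sizes
   d_0 <= d_1 <= ... <= d_(n-1), d_j <= j, of its strict down-sets: it is
   isomorphic to the order in which i lies below j iff i < d_j. Let the rank of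
   j be 0 if d_j = 0, and one more than the rank of d_j - 1 otherwise; the
   length is the largest rank. Building (d_j) one entry at a time, the number of
   completions depends only on the number k of ranks still available, the size
   b of the current rank class so far and the number x of values that d can
   still grow within it, and its generating function is g_k^b g_(k+1)^(x+1),
   where g_0 = 1 and g_(k+1) = 1 / (1 - z g_k). So the semiorders of length at
   most h have generating function g_(h+1), which also counts the closed walks
   of length 2n from an end of a path with h + 2 vertices. The latter are
   counted by the eigenvectors (sin (i j pi / (h + 3)))_i of the path, whose
   eigenvalues are 2 cos (j pi / (h + 3)). *)

(** * Lists of down-set sizes and their ranks *)

(* The possible entries j, ..., j + m - 1 of (d_i) when v is the previous entry,
   s is the first index of the current rank class, and at most k further ranks
   may be opened. The next entry stays in the class iff it is at most s. *)
Fixpoint down_lists (k v s j m : nat) : seq (seq nat) :=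
  if m is m'.+1 then
    [seq w :: l | w <- iota v (j.+1 - v),
                  l <- if w <= s then down_lists k w s j.+1 m'
                       else if k is k'.+1 then down_lists k' w j j.+1 m'
                       else [::]]
  else [:: [::]].

Lemma down_lists_uniq k v s j m : uniq (down_lists k v s j m).
Proof.
elim: m k v s j => [|m IH] k v s j //=.
apply: allpairs_uniq_dep; first exact: iota_uniq.
  by move=> w _; case: ifP => // _; case: k.
by move=> [w l] [w' l'] _ _ /= [-> ->].
Qed.

Lemma down_lists_shape k v s j m l : l \in down_lists k v s j m ->
  [/\ size l = m, path leq v l & forall i, i < m -> nth 0 l i <= j + i].
Proof.
elim: m k v s j l => [|m IH] k v s j l /=.
  by rewrite inE => /eqP ->.
case/allpairsPdep=> w [l' [wi l'i ->]].
move: wi; rewrite mem_iota => wi.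
have [sz pth bd] : [/\ size l' = m, path leq w l' &
    forall i, i < m -> nth 0 l' i <= j.+1 + i].
  by move: l'i; case: ifP => _; [apply: IH | case: k => // k; apply: IH].
split=> /=; [by rewrite sz | by rewrite pth andbT; lia |].
by case=> [|i] /=; [lia | move/bd; lia].
Qed.

(* For a sequence d of down-set sizes, e (d i) is the rank of i, and e i.+1 is
   the number of elements of a longest chain ending at i. *)
Section Rank.
Variable d : nat -> nat.
Hypothesis d_le : forall i, d i <= i.

Lemma rank_exists :
  exists2 e : nat -> nat, e 0 = 0 & forall i, e i.+1 = (e (d i)).+1.
Proof.
(* The recursion from [i.+1] to [d i] is not structural, so [r] carries fuel [f]; as [d i <= i], any
   fuel at least [v] gives the same value. *)
pose fix r (f v : nat) {struct f} :=
  if v is v'.+1 then if f is f'.+1 then (r f' (d v')).+1 else 0 else 0.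
have rE f1 f2 v : v <= f1 -> v <= f2 -> r f1 v = r f2 v.
  elim: f1 f2 v => [|f1 IH] [|f2] [|v] //= h1 h2; congr _.+1.
  by apply: IH; have := d_le v; lia.
exists (fun v => r v v) => // i /=; congr _.+1.
by apply: rE; have := d_le i; lia.
Qed.

Variable e : nat -> nat.
Hypothesis d_homo : {homo d : i j / i <= j}.
Hypotheses (e0 : e 0 = 0) (eS : forall i, e i.+1 = (e (d i)).+1).

Lemma rank_homo : {homo e : i j / i <= j}.
Proof.
move=> i j; elim/ltn_ind: j i => -[|j] IH [|i] // hij; rewrite ?e0 //.
by rewrite !eS ltnS; apply: IH; [have := d_le j; lia | apply: d_homo].
Qed.

(** The last two hypotheses say that indices below [s] have rank less than [e v], and those from [s]
    to [j - 1] rank exactly [e v]. So a next entry in [[v, s]] keeps this rank, while one above [s]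
    raises it by exactly one and opens a class at [j]. *)
Lemma mem_down_lists k v s j m : v <= s -> s <= j -> v <= d j ->
    (forall i, i <= s -> e i <= e v) ->
    (forall i, s < i <= j -> e i = (e v).+1) ->
  [seq d i | i <- iota j m] \in down_lists k v s j m <->
    (forall i, j <= i < j + m -> e (d i) <= e v + k).
Proof.
elim: m k v s j => [|m IH] k v s j vs sj vd lo hi /=.
  by rewrite inE eqxx; split=> // _ i; lia.
have dj : d j \in iota v (j.+1 - v).
  by rewrite mem_iota; have := d_le j; lia.
have memE (L : nat -> seq (seq nat)) l :
    (d j :: l \in [seq w :: l | w <- iota v (j.+1 - v), l <- L w]) = (l \in L (d j)).
  apply/allpairsPdep/idP => [[w [l' [_ ? [-> ->]]]] //|?].
  by exists (d j), l.
rewrite (memE (fun w => if w <= s then _ else _)).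
have step k' w : e (d j) = e w ->
   (forall i, j <= i < j + m.+1 -> e (d i) <= e w + k') <->
   (forall i, j.+1 <= i < j.+1 + m -> e (d i) <= e w + k').
  move=> E; split=> H i hi'; first by apply: H; lia.
  by have [<-|?] := eqVneq j i; [rewrite E leq_addr | apply: H; lia].
case: ifP => ds.
  have E : e (d j) = e v by apply/eqP; rewrite eqn_leq lo // rank_homo.
  rewrite step // -E; apply: IH => //; rewrite ?E //; [lia | exact: d_homo |].
  move=> i /andP[si]; rewrite leq_eqVlt => /predU1P[->|]; first by rewrite eS E.
  by move=> ij; apply: hi; lia.
have E : e (d j) = (e v).+1 by apply: hi; have := d_le j; lia.
case: k => [|k].
  split=> // H; have := H j; rewrite E; lia.
have -> : e v + k.+1 = e (d j) + k by lia.
rewrite step //; apply: IH => //; [exact: d_homo | |].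
  move=> i ij; rewrite E; have [/lo|si] := leqP i s; first lia.
  by rewrite hi // si.
by move=> i ij; have -> : i = j.+1 by lia.
Qed.

End Rank.

(** * Consequences of excluding 2+2 and 3+1 *)

Section ForbiddenSubposets.
Variables (T : eqType) (le : rel T).
Hypothesis le_semi : is_semiorder le.

Definition strict (r : rel T) : rel T := fun x y => (x != y) && r x y.

Lemma mono_embeds (U : Type) (leU : rel U) (f : U -> T) :
  antisymmetric leU -> {mono f : x y / leU x y >-> le x y} -> embeds leU le.
Proof.
move=> antiU fm; exists f => // x y fxy; apply: antiU.
by case: le_semi => -[refl _ _] _ _; rewrite -!fm fxy refl.
Qed.

Lemma chain_le_anti k : antisymmetric (@chain_le k).
Proof. by move=> x y /anti_leq /val_inj. Qed.

Lemma sum_le_anti (A B : Type) (leA : rel A) (leB : rel B) :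
  antisymmetric leA -> antisymmetric leB -> antisymmetric (sum_le leA leB).
Proof. by move=> hA hB [a|b] [a'|b'] //= => [/hA|/hB] ->. Qed.

Lemma semiorder_2p2 a b c e :
  strict le a b -> strict le c e -> strict le a e || strict le c b.
Proof.
case: (le_semi) => -[refl anti trans] no22 _ /andP[ab leab] /andP[ce lece].
apply/negPn/negP; rewrite negb_or => /andP[nae ncb].
(* Coincidences must be excluded too: [a = e] would give c < e = a < b, hence [strict le c b]. *)
have leae : le a e = false.
  apply: contraNF nae => leae; rewrite /strict leae andbT.
  apply: contra ncb => /eqP ae; subst e.
  rewrite /strict (trans a) ?andbT //.
  by apply: contraNneq ab => cb; apply/eqP/anti; rewrite leab -cb.
have lecb : le c b = false.
  apply: contraNF ncb => lecb; rewrite /strict lecb andbT.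
  apply: contraNneq ab => cb; apply/eqP/anti; rewrite leab /=.
  by move: leae; rewrite (trans b) // -cb.
case: no22; apply: (@mono_embeds _ _ (fun u : 'I_2 + 'I_2 => match u with
  | inl i => if i == 0 :> nat then a else b
  | inr i => if i == 0 :> nat then c else e end)).
  by apply: sum_le_anti; apply: chain_le_anti.
(* The two failures a <= e and c <= b propagate along a <= b and c <= e to all other cross pairs. *)
have tr x y z : le x y -> le x z = false -> le y z = false.
  by move=> xy; apply: contraFF => /(trans _ _ _ xy).
have tl x y z : le y z -> le x z = false -> le x y = false.
  by move=> yz; apply: contraFF => xy; apply: trans xy yz.
have leba : le b a = false.
  by apply: contraNF ab => h; apply/eqP/anti; rewrite leab.
have leec : le e c = false.
  by apply: contraNF ce => h; apply/eqP/anti; rewrite lece.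
by do 2 (case=> -[[|[|?]] ?]) => //=; rewrite /chain_le ?refl //=;
  do ?[exact: (tr _ _ _ leab leae) | exact: (tl _ _ _ lece leae)
     | exact: (tr _ _ _ lece lecb) | exact: (tl _ _ _ leab lecb)
     | exact: (tr _ _ _ leab (tl _ _ _ lece leae))
     | exact: (tr _ _ _ lece (tl _ _ _ leab lecb))].
Qed.

Lemma semiorder_3p1 a b c x :
  strict le a b -> strict le b c -> strict le a x || strict le x c.
Proof.
case: (le_semi) => -[refl anti trans] _ no31 /andP[ab leab] /andP[bc lebc].
apply/negPn/negP; rewrite negb_or => /andP[nax nxc].
have leac := trans _ _ _ leab lebc.
have leba : le b a = false.
  by apply: contraNF ab => h; apply/eqP/anti; rewrite leab.
have lecb : le c b = false.
  by apply: contraNF bc => h; apply/eqP/anti; rewrite lebc.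
have leca : le c a = false.
  by apply: contraFF lecb => h; apply: trans h leab.
have ac : a != c by apply: contraFneq leca => ->.
have leax : le a x = false.
  apply: contraNF nax => leax; rewrite /strict leax andbT.
  by apply: contra nxc => /eqP <-; rewrite /strict ac.
have lexc : le x c = false.
  apply: contraNF nxc => lexc; rewrite /strict lexc andbT.
  by apply: contraFneq leax => ->.
case: no31; apply: (@mono_embeds _ _ (fun u : 'I_3 + 'I_1 => match u with
  | inl i => if i == 0 :> nat then a else if i == 1 :> nat then b else c
  | inr i => x end)).
  by apply: sum_le_anti; apply: chain_le_anti.
have tr u v w : le u v -> le u w = false -> le v w = false.
  by move=> uv; apply: contraFF => /(trans _ _ _ uv).
have tl u v w : le v w -> le u w = false -> le u v = false.
  by move=> vw; apply: contraFF => uv; apply: trans uv vw.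
by case=> -[[|[|[|?]]] ?] => //=; case=> -[[|[|[|?]]] ?] => //=;
  rewrite /chain_le ?refl //=;
  do ?[exact: (tr _ _ _ leab leax) | exact: (tl _ _ _ lebc lexc)
     | exact: (tr _ _ _ leac leax) | exact: (tl _ _ _ leac lexc)].
Qed.

(** The trace of the order: strict down-sets grow and strict up-sets shrink. Sorting by it yields
    the labelling of the canonical form. *)
Definition dominated : rel T := fun x y =>
  `[< forall z, (strict le z x -> strict le z y) /\ (strict le y z -> strict le x z) >].

Lemma dominated_trans : transitive dominated.
Proof.
move=> y x z /asboolP xy /asboolP yz; apply/asboolP => w.
by have [? ?] := xy w; have [? ?] := yz w; split; auto.
Qed.

(** A failure of [dominated x y] has a witness [z] in a down-set or an up-set. A failure of
    [dominated y x] on the same side would give a 2+2, one on the other side a 3+1. *)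
Lemma dominated_total : total dominated.
Proof.
move=> x y; apply/orP; have [|/asboolPn/existsNP[z nz]] := boolP (dominated x y); first by left.
right; apply/asboolP => w.
have {nz} [|] : (strict le z x /\ ~~ strict le z y) \/ (strict le y z /\ ~~ strict le x z).
  by have /not_andP[/not_implyP[? /negP]|/not_implyP[? /negP]] := nz; [left | right].
- move=> [zx /negbTE nzy]; split=> [wy|xw].
    by have := semiorder_2p2 zx wy; rewrite nzy.
  by have := semiorder_3p1 y zx xw; rewrite nzy.
- move=> [yz /negbTE nxz]; split=> [wy|xw].
    by have := semiorder_3p1 x wy yz; rewrite nxz orbF.
  by have := semiorder_2p2 yz xw; rewrite nxz orbF.
Qed.

End ForbiddenSubposets.

(** * Length of the order given by down-set sizes *)

Lemma poset_lengthP (T : finType) (leT : rel T) h :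
  (poset_length leT <= h) <->
  (forall C : {set T}, {in C &, total leT} -> #|C| <= h.+1).
Proof.
rewrite /poset_length; set m := \max_(C | _) _.
have -> : (m.-1 <= h) = (m <= h.+1) by lia.
split=> [/bigmax_leqP H C tC|H]; first by apply: H; apply/asboolP.
by apply/bigmax_leqP => C /asboolP; apply: H.
Qed.

Section DownSetOrder.
Variables (n : nat) (d : nat -> nat) (le : rel 'I_n).
Hypotheses (d_le : forall i, d i <= i) (d_homo : {homo d : i j / i <= j}).
Hypothesis leE : forall x y, le x y = (x == y) || (x < d y).

Lemma down_poset : is_poset le.
Proof.
split=> [x|x y|y x z]; rewrite !leE ?eqxx //.
  case/andP=> /predU1P[//|xy] /predU1P[//|yx].
  by have := d_le x; have := d_le y; lia.
case/predU1P=> [->|xy] //; case/predU1P=> [<-|yz]; first by rewrite xy orbT.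
have dyz : d y <= d z by apply: d_homo; have := d_le z; lia.
by rewrite (leq_trans xy) ?orbT.
Qed.

Lemma embeds_strict (U : eqType) (leU : rel U) (f : U -> 'I_n) u v : injective f ->
  {mono f : x y / leU x y >-> le x y} -> u != v -> (f u < d (f v)) = leU u v.
Proof. by move=> fi fm uv; rewrite -fm leE (inj_eq fi) (negbTE uv). Qed.

(** Chains a < b and c < e forming a 2+2 would give the cycle d e <= a < d b <= c < d e. For a < b <
    c and x forming a 3+1, b < d c <= x gives d b <= d x by monotonicity, against d x <= a < d b. *)
Lemma down_semiorder : is_semiorder le.
Proof.
split; first exact: down_poset.
- move=> [f fi fm].
  have S := embeds_strict fi fm.
  have h1 := S (inl ord0) (inl ord_max) isT.
  have h2 := S (inr ord0) (inr ord_max) isT.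
  have h3 := S (inl ord0) (inr ord_max) isT.
  have h4 := S (inr ord0) (inl ord_max) isT.
  by move: h1 h2 h3 h4; rewrite /= /chain_le /=; lia.
- move=> [f fi fm].
  have S := embeds_strict fi fm.
  pose o1 : 'I_3 := @Ordinal 3 1 isT.
  have h1 := S (inl ord0) (inl o1) isT.
  have h2 := S (inl o1) (inl ord_max) isT.
  have h3 := S (inl ord0) (inr ord0) isT.
  have h4 := S (inr ord0) (inl ord_max) isT.
  have h5 := d_le (f (inl o1)).
  have h6 : f (inl o1) <= f (inr ord0) -> d (f (inl o1)) <= d (f (inr ord0)) by exact: d_homo.
  by move: h1 h2 h3 h4; rewrite /= /chain_le /=; lia.
Qed.

Variable e : nat -> nat.
Hypotheses (e0 : e 0 = 0) (eS : forall i, e i.+1 = (e (d i)).+1).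

Lemma rank_chain v : v <= n -> exists C : {set 'I_n},
  [/\ {in C &, total le}, #|C| = e v & forall x, x \in C -> x < v].
Proof.
elim/ltn_ind: v => -[|i] IH vn.
  exists finset.set0; rewrite cards0 e0; split=> // x; first by move=> y; rewrite inE.
  by rewrite inE.
have [||C [tC cC ltC]] := IH (d i); [by have := d_le i; lia .. |].
pose x := Ordinal vn.
have xC : x \notin C by apply/negP => /ltC /=; have := d_le i; lia.
have ltx y : y \in C -> le y x by move=> /ltC yd; rewrite leE yd orbT.
exists (x |: C); split.
- move=> y z; rewrite !inE => /predU1P[->|yC] /predU1P[->|zC].
  + by rewrite leE eqxx.
  + by rewrite ltx ?orbT.
  + by rewrite ltx.
  + exact: tC.
- by rewrite cardsU1 xC cC eS.
- by move=> y; rewrite !inE => /predU1P[-> //=|/ltC]; have := d_le i; lia.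
Qed.

Lemma down_length h : poset_length le <= h <-> (forall i, i < n -> e (d i) <= h).
Proof.
rewrite poset_lengthP; split=> [H i lt_in | H C tC].
  have [C [tC cC _]] := rank_chain lt_in.
  by have := H C tC; rewrite cC eS ltnS.
(* The rank increases strictly along the order, so it is injective on a chain and takes at most
   [h.+1] values. *)
pose r (x : 'I_n) : 'I_h.+1 := inord (e (d x)).
rewrite -[h.+1]card_ord -(@card_in_imset _ _ r C) ?max_card //.
have lt_r x y : x < d y -> e (d x) < e (d y).
  case dy : (d y) => [|z] // xz; rewrite eS ltnS.
  by apply: (rank_homo d_le d_homo e0 eS); apply: d_homo.
move=> x y xC yC /(congr1 val); rewrite /= !inordK ?ltnS ?H // => exy.
by have /orP := tC x y xC yC; rewrite !leE => -[] /predU1P[//|/lt_r]; rewrite exy ltnn.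
Qed.

End DownSetOrder.

Lemma isomorphic_sym (T U : Type) (leT : rel T) (leU : rel U) :
  isomorphic leT leU -> isomorphic leU leT.
Proof.
case=> f [g fK gK] fm; exists g; first by exists f.
by move=> x y; rewrite -fm !gK.
Qed.

Lemma isomorphic_trans (T U V : Type) (leT : rel T) (leU : rel U) (leV : rel V) :
  isomorphic leT leU -> isomorphic leU leV -> isomorphic leT leV.
Proof.
case=> f fb fm [g gb gm]; exists (g \o f); first exact: bij_comp.
by move=> x y; rewrite /= gm fm.
Qed.

Lemma isomorphic_length (T U : finType) (leT : rel T) (leU : rel U) h :
  isomorphic leT leU -> poset_length leT <= h -> poset_length leU <= h.
Proof.
case/isomorphic_sym=> f fb fm /poset_lengthP H; apply/poset_lengthP => C tC.
rewrite -(card_imset _ (bij_inj fb)); apply: H => _ _ /imsetP[x xC ->] /imsetP[y yC ->].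
by rewrite !fm; apply: tC.
Qed.

(** * Canonical forms and isomorphism classes *)

Section CanonicalForms.
Variable n : nat.

Definition down_seq (l : seq nat) : Prop :=
  [/\ size l = n, sorted leq l & forall i, i < n -> nth 0 l i <= i].

(* With default value n, nth n l is nondecreasing and nth n l i <= i on the whole
   of nat. *)
Definition down_graph (l : seq nat) : {set 'I_n * 'I_n} :=
  [set p : 'I_n * 'I_n | (p.1 == p.2) || (p.1 < nth n l p.2)].

Lemma down_graphE l x y :
  rel_of (down_graph l) x y = (x == y) || (x < nth n l y).
Proof. by rewrite /rel_of inE. Qed.

Lemma down_seq_le l : down_seq l -> forall i, nth n l i <= i.
Proof.
case=> sz _ H i; have [lt_in|le_ni] := ltnP i n; last by rewrite nth_default ?sz.
by rewrite (set_nth_default 0) ?sz // H.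
Qed.

Lemma down_seq_homo l : down_seq l -> {homo nth n l : i j / i <= j}.
Proof.
move=> dl; have [sz srt _] := dl; move=> i j ij.
have [lt_jn|le_nj] := ltnP j n.
  by apply: (sorted_leq_nth leq_trans leqnn) => //; rewrite inE sz //; lia.
rewrite [nth n l j]nth_default ?sz //.
have [lt_in|le_ni] := ltnP i n; last by rewrite nth_default ?sz.
by have := down_seq_le dl i; lia.
Qed.

Lemma down_graph_strict l x y : down_seq l ->
  strict (rel_of (down_graph l)) x y = (x < nth n l y).
Proof.
move=> dl; rewrite /strict down_graphE; case: eqVneq => [->|//].
by have := down_seq_le dl y; lia.
Qed.

Lemma map_nth_ord l : size l = n -> [seq nth n l (val i) | i <- enum 'I_n] = l.
Proof. by move=> sz; rewrite map_comp val_enum_ord -sz; apply: mkseq_nth. Qed.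

Lemma card_strict_below l x : down_seq l ->
  #|[set y | strict (rel_of (down_graph l)) y x]| = nth n l x.
Proof.
move=> dl; have dn : nth n l x <= n by have := down_seq_le dl x; have := ltn_ord x; lia.
have -> : [set y | strict (rel_of (down_graph l)) y x] =
    [set widen_ord dn i | i : 'I_(nth n l x)].
  apply/setP => y; rewrite inE down_graph_strict //.
  apply/idP/imsetP => [yx|[i _ ->]]; last exact: (ltn_ord i).
  by exists (Ordinal yx) => //; apply: val_inj.
rewrite card_imset ?cardsT ?card_ord //.
by move=> i j /(congr1 val) /= /val_inj.
Qed.

(* The multiset of sizes of strict down-sets is an isomorphism invariant. *)
Lemma down_graph_inj l l' : down_seq l -> down_seq l' ->
  isomorphic (rel_of (down_graph l)) (rel_of (down_graph l')) -> l = l'.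
Proof.
move=> dl dl' [f fb fm]; have fi := bij_inj fb.
have [sz srt _] := dl; have [sz' srt' _] := dl'.
have lf x : nth n l' (f x) = nth n l x.
  rewrite -!card_strict_below // -[RHS](card_imset _ fi); congr #|pred_of_set _|.
  apply/setP => y; case: (fb) => g fK gK.
  rewrite -[y]gK (mem_imset _ _ fi) !inE /strict fm.
  by rewrite (inj_eq fi).
apply: (sorted_eq leq_trans anti_leq) => //.
have -> : l = [seq nth n l' (val i) | i <- [seq f i | i <- enum 'I_n]].
  rewrite -map_comp -[LHS](map_nth_ord sz).
  by apply: eq_map => i /=; rewrite lf.
rewrite -[X in perm_eq _ X](map_nth_ord sz').
apply: perm_map; apply: uniq_perm => [||y]; [|exact: enum_uniq|].
  by rewrite (map_inj_uniq fi) enum_uniq.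
rewrite mem_enum; apply/mapP; case: (fb) => g fK gK; exists (g y) => //.
by rewrite mem_enum.
Qed.

(** With the elements listed along [dominated], the strict order [R] on positions persists when its
    left index decreases or its right index increases. So the positions below [j] form an initial
    segment, whose length is nondecreasing in [j]. *)
Lemma semiorder_down_graph (G : {set 'I_n * 'I_n}) : is_semiorder (rel_of G) ->
  exists2 l, down_seq l & isomorphic (rel_of (down_graph l)) (rel_of G).
Proof.
set le := rel_of G => sG; have [[refl anti trans] _ _] := sG.
have [n0|n_gt0] := posnP n.
  exists [::]; first by split; rewrite ?n0.
  have no (x : 'I_n) : False by have := ltn_ord x; lia.
  by exists id; [exists id | move=> x].
pose x0 := Ordinal n_gt0.
pose s := sort (dominated le) (enum 'I_n).
have sz : size s = n by rewrite size_sort size_enum_ord.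
have us : uniq s by rewrite sort_uniq enum_uniq.
pose x i := nth x0 s i; pose R i j := strict le (x i) (x j).
have xdom i j : i <= j < n -> dominated le (x i) (x j).
  move=> ijn; have dt : transitive (dominated le) by apply: dominated_trans.
  have dtot : total (dominated le) by apply: dominated_total.
  apply: (sorted_leq_nth dt _ _ (sort_sorted dtot _)); rewrite ?inE ?sz //; try lia.
  by move=> z; have := dtot z z; rewrite orbb.
have Rl i i' j : i' <= i -> i < n -> R i j -> R i' j.
  by move=> ii lt_in; have /asboolP/(_ (x j))[_] := xdom i' i ltac:(lia); apply.
have Rr i j j' : j <= j' -> j' < n -> R i j -> R i j'.
  by move=> jj lt_jn; have /asboolP/(_ (x i))[+ _] := xdom j j' ltac:(lia); apply.
have Rlt i j : i < n -> R i j -> i < j.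
  move=> lt_in Rij; rewrite ltnNge; apply/negP => ji.
  by have := Rl i j j ji lt_in Rij; rewrite /R /strict eqxx.
(* The first position not below [j]; [find] returns [n] if there is none. *)
pose d j := find (fun i => ~~ R i j) (iota 0 n).
have dn j : d j <= n by rewrite -[X in _ <= X](size_iota 0) find_size.
have dP i j : i < n -> R i j = (i < d j).
  move=> lt_in; apply/idP/idP => [Rij|].
    rewrite ltnNge; apply/negP => di.
    have dlt : d j < n by lia.
    have := @nth_find _ 0 (fun i => ~~ R i j) (iota 0 n).
    rewrite has_find size_iota -/(d j) dlt nth_iota // add0n => /(_ isT) /negP; apply.
    exact: Rl Rij.
  move/(@before_find _ 0); rewrite nth_iota // add0n.
  by move/negbT; rewrite negbK.
have d_le j : j < n -> d j <= j.
  move=> jn; rewrite leqNgt -dP //; apply/negP => Rjj.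
  by have := Rlt j j jn Rjj; rewrite ltnn.
have dl : down_seq (mkseq d n).
  split; first by rewrite size_mkseq.
    apply/(sortedP 0) => i; rewrite size_mkseq => lt_in.
    rewrite !nth_mkseq //; last by apply: ltnW.
    rewrite leqNgt; apply/negP => dd; have dlt := leq_trans dd (dn i).
    by have := Rr (d i.+1) i i.+1 (leqnSn i) lt_in; rewrite !dP // dd ltnn => /(_ isT).
  by move=> i lt_in; rewrite nth_mkseq // d_le.
exists (mkseq d n) => //.
have xb : bijective (fun i : 'I_n => x i).
  apply: injF_bij => i j /eqP; rewrite nth_uniq ?sz // => /eqP; exact: val_inj.
exists (fun i : 'I_n => x i) => // i j.
rewrite down_graphE nth_mkseq // -dP // /R /strict -(inj_eq (bij_inj xb)).
by case: eqVneq => [->|_]; rewrite ?refl.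
Qed.

Lemma mem_down_lists0 h l : l \in down_lists h 0 0 0 n <->
  down_seq l /\ poset_length (rel_of (down_graph l)) <= h.
Proof.
have main : down_seq l ->
    l \in down_lists h 0 0 0 n <-> poset_length (rel_of (down_graph l)) <= h.
  move=> dl; have [sz _ _] := dl; pose d := nth n l.
  have d_le := down_seq_le dl; have d_homo := down_seq_homo dl.
  have [e e0 eS] := rank_exists d_le.
  rewrite (down_length d_le d_homo (down_graphE l) e0 eS).
  have {1}<- : [seq d i | i <- iota 0 n] = l by rewrite -[X in iota _ X]sz; apply: mkseq_nth.
  rewrite (mem_down_lists d_le d_homo e0 eS) // => [|i|i]; [|by rewrite leqn0 => /eqP ->|lia].
  by rewrite e0 !add0n.
split=> [lL|[dl]]; last by rewrite main.
suff dl : down_seq l by split=> //; apply/main.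
have [sz pth bd] := down_lists_shape lL; split=> //.
by case: (l) pth => //= a l' /andP[].
Qed.

End CanonicalForms.

(** Every isomorphism class contains [down_graph n l] for exactly one list [l]. *)
Lemma num_semiordersE h n : num_semiorders h n = size (down_lists h 0 0 0 n).
Proof.
rewrite /num_semiorders; set S := semiorders h n; set L := down_lists _ _ _ _ _.
pose iso (G H : {set 'I_n * 'I_n}) := `[< isomorphic (rel_of G) (rel_of H) >].
pose cls G := [set H in S | iso G H].
have clsE G H : isomorphic (rel_of G) (rel_of H) -> cls G = cls H.
  move=> GH; apply/setP => K; rewrite !inE; congr (_ && _).
  apply/asboolP/asboolP; apply: isomorphic_trans => //.
  exact: isomorphic_sym.
have LS l : l \in L -> down_graph n l \in S.
  move=> /mem_down_lists0 [dl len]; rewrite inE len andbT; apply/asboolP.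
  exact: down_semiorder (down_seq_le dl) (down_seq_homo dl) (down_graphE l).
have iso_refl G : isomorphic (rel_of G) (rel_of G) by exists id => //; exists id.
have -> : equivalence_partition iso S =
    [set c in [seq cls (down_graph n l) | l <- L]].
  apply/setP => c; rewrite inE; apply/imsetP/mapP => [[G GS ->]|[l lL ->]]; last first.
    by exists (down_graph n l) => //; apply: LS.
  move: (GS); rewrite inE => /andP[/asboolP sG len].
  have [l dl lG] := semiorder_down_graph sG; exists l.
    apply/mem_down_lists0; split=> //.
    exact: isomorphic_length (isomorphic_sym lG) len.
  by rewrite -/(cls G) (clsE _ _ lG).
rewrite cardsE; have /card_uniqP -> : uniq [seq cls (down_graph n l) | l <- L].
  rewrite map_inj_in_uniq ?down_lists_uniq // => l l' lL lL' cE.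
  have /mem_down_lists0[dl _] := lL; have /mem_down_lists0[dl' _] := lL'.
  apply: (down_graph_inj dl dl').
  have : down_graph n l' \in cls (down_graph n l').
    by rewrite inE LS //; apply/asboolP.
  by rewrite -cE inE => /andP[_ /asboolP].
by rewrite size_map.
Qed.

Local Open Scope ring_scope.

(** * Continued fractions and walks on a path *)

Section ContinuedFraction.
Variables (R : comNzRingType) (N : nat).

(* g_k modulo 'X^N, in the variable z = 'X^2, so that exponents are lengths of
   walks. *)
Fixpoint cfrac (k : nat) : {poly R} :=
  if k is k'.+1 then \sum_(b < N) ('X^2 * cfrac k') ^+ b else 1.

(** The geometric sum satisfies g_(k+1) = 1 + z g_k g_(k+1) up to a multiple of ['X^(2 * N)],
    invisible in degrees below [N]. *)
Lemma coef_cfracM k (q : {poly R}) p : (p < N)%N ->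
  (q * cfrac k.+1)`_p = q`_p + ('X^2 * (q * cfrac k * cfrac k.+1))`_p.
Proof.
move=> pN; have gS : cfrac k.+1 =
    1 + 'X^2 * cfrac k * cfrac k.+1 - ('X^2 * cfrac k) ^+ N.
  have := subrX1 ('X^2 * cfrac k) N; rewrite -/(cfrac k.+1) => /eqP.
  by rewrite subr_eq => /eqP ->; ring.
rewrite {1}gS; have -> : q * (1 + 'X^2 * cfrac k * cfrac k.+1 - ('X^2 * cfrac k) ^+ N)
   = q + 'X^2 * (q * cfrac k * cfrac k.+1) - 'X^(2 * N) * (q * cfrac k ^+ N).
  rewrite exprMn -exprM; move: (cfrac k) (cfrac k.+1) 'X^(2 * N) => a b c.
  by move: (a ^+ N) => d; ring.
by rewrite coefB coefD [X in _ - X]coefXnM ifT ?subr0 //; lia.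
Qed.

Lemma coef_cfrac_exp k (q : {poly R}) x p : (p < N)%N ->
  (q * cfrac k.+1 ^+ x)`_p =
    q`_p + \sum_(0 <= y < x) ('X^2 * (q * cfrac k * cfrac k.+1 ^+ y.+1))`_p.
Proof.
move=> pN; elim: x => [|x IH]; first by rewrite big_geq // expr0 mulr1 addr0.
rewrite exprSr mulrA coef_cfracM // IH big_nat_recr //= addrA.
rewrite [cfrac k.+1 ^+ x.+1]exprSr; congr (_ + ('X^2 * _)`_p).
by rewrite !mulrA [q * _ * cfrac k]mulrAC.
Qed.

Lemma sum_down (V : nmodType) (F : nat -> V) s v : (v <= s)%N ->
  \sum_(v <= w < s.+1) F (s - w)%N = \sum_(0 <= x < (s - v).+1) F x.
Proof.
move=> vs; rewrite big_nat_rev -{1}[v]add0n big_addn subSn //.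
by apply: eq_big_nat => i hi; congr F; lia.
Qed.

(** Split by the next entry [w]. Expanding the power of g_(k+1) by [coef_cfrac_exp] gives one term
    for each [w] in [[v, s]]; expanding the remaining power of g_k gives one for each [w] in
    [[s.+1, j]]. In the latter case the new class already contains [j], whence the single factor
    g_(k-1). *)
Lemma size_down_lists k v s j m : (v <= s <= j)%N -> (m.*2 < N)%N ->
  (size (down_lists k v s j m))%:R =
    (cfrac k ^+ (j - s) * cfrac k.+1 ^+ (s - v).+1)`_(m.*2) :> R.
Proof.
elim: m k v s j => [|m IH] k v s j /andP[vs sj] mN.
  have coef0_exp a q x : (q * cfrac a.+1 ^+ x)`_0 = q`_0.
    rewrite coef_cfrac_exp // big1 ?addr0 // => i _.
    by rewrite coefXnM.
  rewrite coef0_exp; case: k => [|k] /=; first by rewrite expr1n coef1.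
  by rewrite -[_ ^+ _]mul1r coef0_exp coef1.
have coefX2M (q : {poly R}) : ('X^2 * q)`_(m.+1.*2) = q`_(m.*2).
  by rewrite coefXnM doubleS /= subn2.
have m2N : (m.*2 < N)%N by lia.
rewrite coef_cfrac_exp // size_allpairs_dep sumnE big_map.
have -> : iota v (j.+1 - v) = index_iota v j.+1 by [].
rewrite (big_cat_nat (n := s.+1)) //=; last lia.
rewrite natrD addrC; congr (_ + _); last first.
  rewrite -sum_down // natr_sum; apply: eq_big_nat => w /andP[vw ws].
  rewrite -ltnS ws IH ?coefX2M //; last lia.
  by rewrite -exprSr subSn.
(* With no rank left, entries above [s] contribute nothing, matching g_0 = 1. *)
case: k => [|k].
  rewrite expr1n coef1 /= natr_sum big_nat_cond big1 // => w.
  by move=> /andP[/andP[sw _] _]; rewrite leqNgt sw.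
rewrite -[_ ^+ _]mul1r coef_cfrac_exp // coef1 /= add0r.
have [->|ltsj] := eqVneq s j; first by rewrite subnn !big_geq.
have -> : (j - s = (j - s.+1).+1)%N by lia.
rewrite -(sum_down (fun x => ('X^2 * (1 * cfrac k * cfrac k.+1 ^+ x.+1))`_m.+1.*2)); last lia.
rewrite natr_sum; apply: eq_big_nat => w /andP[sw wj].
rewrite leqNgt sw /= IH //; last lia.
by rewrite coefX2M subSn // subnn expr1 mul1r.
Qed.

(* 'X^i times this counts the walks from vertex 0 to vertex i of a path with
   vertices 0, ..., k, by decomposition at the last visits to 0, ..., i - 1. *)
Fixpoint cfrac_prod (k i : nat) : {poly R} :=
  if i is i'.+1 then cfrac_prod k i' * cfrac (k - i) else cfrac k.

End ContinuedFraction.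

(* The recursion of the numbers T p i of walks of length p from 0 to i on the
   path 0, ..., K, with the convention that T vanishes at K.+1. *)
Section Walk.
Variables (R : comNzRingType) (N K : nat) (T : nat -> nat -> R).
Hypothesis K_gt0 : (0 < K)%N.
Hypothesis T0 : forall i, (i <= K.+1)%N -> T 0 i = (i == 0)%:R.
Hypothesis TS0 : forall p, T p.+1 0 = T p 1.
Hypothesis TS : forall p i, (i <= K)%N -> T p.+1 i.+1 = T p i + T p i.+2.
Hypothesis Tend : forall p, T p K.+1 = 0.

Lemma coef_walk p i : (p < N)%N -> (i <= K)%N ->
  ('X^i * cfrac_prod R N K i)`_p = T p i.
Proof.
elim: p i => [|p IH] i pN iK.
  rewrite T0 //; last lia.
  case: i iK => [|i] iK; last by rewrite coefXnM.
  rewrite expr0 mul1r /=; case: K => [|k]; first by rewrite coef1.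
  by rewrite -[cfrac _ _ _]mul1r coef_cfracM // coef1 coefXnM addr0.
have pN' : (p < N)%N by lia.
case: i iK => [|i] iK.
  rewrite TS0 -IH // expr0 mul1r expr1 /=.
  have -> : K = (K.-1).+1 by lia.
  rewrite -[cfrac _ _ _]mul1r coef_cfracM // coef1 add0r mul1r subn1 /=.
  by rewrite exprS expr1 -mulrA coefXM /= mul1r [cfrac _ _ _ * _]mulrC.
rewrite TS; last lia.
have q_coef : ('X^(i.+1) * cfrac_prod R N K i)`_p.+1 = T p i.
  by rewrite exprS -mulrA coefXM /= IH //; lia.
(* At the far end the new factor is g_0 = 1 and [T] vanishes at [i.+2]; otherwise g = 1 + z g' g
   splits walks by whether the last step comes from [i] or from [i.+2]. *)
rewrite /= mulrA; case kE : (K - i.+1)%N => [|k].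
  have -> : i.+2 = K.+1 by lia.
  by rewrite Tend addr0 mulr1.
rewrite coef_cfracM // q_coef; congr (_ + _).
rewrite -IH //; last lia.
rewrite (_ : cfrac_prod R N K i.+2 =
  cfrac_prod R N K i * cfrac R N (K - i.+1) * cfrac R N (K - i.+2)) // kE.
rewrite (_ : (K - i.+2)%N = k); last lia.
have -> : 'X^2 * ('X^(i.+1) * cfrac_prod R N K i * cfrac R N k * cfrac R N k.+1) =
  'X * ('X^(i.+2) * (cfrac_prod R N K i * cfrac R N k.+1 * cfrac R N k)).
  rewrite expr2 [X in _ = 'X * (X * _)]exprS -!mulrA.
  by congr (_ * (_ * (_ * (_ * _)))); rewrite mulrC.
by rewrite coefXM.
Qed.

End Walk.

(** * Trigonometric sums *)

Section Sines.
Variables (R : realType) (M : nat).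
Hypothesis M_gt0 : (0 < M)%N.

Let theta : R := pi / M%:R.

Let M_neq0 : M%:R != 0 :> R.
Proof. by rewrite pnatr_eq0 -lt0n. Qed.

Lemma sin_natpi n : sin (n%:R * pi) = 0 :> R.
Proof.
elim: n => [|n IH]; first by rewrite mul0r sin0.
by rewrite -natr1 mulrDl mul1r sinDpi IH oppr0.
Qed.

Lemma cos_natpi n : cos (n%:R * pi) = (-1) ^+ n :> R.
Proof.
elim: n => [|n IH]; first by rewrite mul0r cos0.
by rewrite -natr1 mulrDl mul1r cosDpi IH exprS mulN1r.
Qed.

(** Multiplying by 2 sin b, where b is half the angle step, makes the sum telescope; [r < M.*2]
    keeps b strictly between 0 and pi, so sin b is nonzero. *)
Lemma sum_cos r : (0 < r < M.*2)%N ->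
  \sum_(0 <= j < M) cos (r%:R * (j%:R * theta)) = (odd r)%:R.
Proof.
move=> /andP[r0 rM]; pose b := r%:R * theta / 2.
have sb : sin b != 0.
  apply: lt0r_neq0; apply: sin_gt0_pi.
  have pi0 := pi_gt0 R.
  have M0 : 0 < M%:R :> R by rewrite ltr0n.
  rewrite /b /theta !divr_gt0 ?mulr_gt0 ?ltr0n ?invr_gt0 //=.
  rewrite ltr_pdivrMr // mulrA ltr_pdivrMr // mulrC -mulrA ltr_pM2l //.
  by rewrite -natrM ltr_nat; lia.
have tel n : 2 * sin b * \sum_(0 <= j < n) cos (r%:R * (j%:R * theta)) =
    sin (n%:R * (2 * b) - b) + sin b.
  elim: n => [|n IH]; first by rewrite big_geq // mulr0 mul0r sub0r sinN addNr.
  rewrite big_nat_recr //= mulrDr IH.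
  have -> : r%:R * (n%:R * theta) = n%:R * (2 * b) by rewrite /b; field.
  have -> : n.+1%:R * (2 * b) - b = n%:R * (2 * b) + b by rewrite -natr1; ring.
  by rewrite sinB sinD; ring.
have := tel M; have -> : M%:R * (2 * b) = r%:R * pi.
  by rewrite /b /theta; field.
rewrite sinB sin_natpi cos_natpi mul0r sub0r -signr_odd => h.
have sb2 : 2 * sin b != 0 by rewrite mulf_neq0 ?pnatr_eq0.
apply: (mulfI sb2).
by rewrite h; case: (odd r) => /=; rewrite ?expr0 ?expr1 ?mulr0 ?mulr1; ring.
Qed.

(* The number of walks of length p from an end of the path with M - 1 vertices
   to the i-th vertex, by diagonalization of its adjacency matrix. *)
Definition sine_sum (p i : nat) : R :=
  2 / M%:R * \sum_(0 <= j < M) sin (j%:R * theta) * sin (i.+1%:R * (j%:R * theta))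
     * (2 * cos (j%:R * theta)) ^+ p.

(** By 2 sin x sin((i+1)x) = cos(ix) - cos((i+2)x), this is a difference of two cosine sums of equal
    parity. They cancel, except that for i = 0 the first one is [M]. *)
Lemma sine_sum0 i : (i.+2 < M.*2)%N -> sine_sum 0 i = (i == 0)%:R.
Proof.
move=> iM; rewrite /sine_sum.
transitivity (M%:R^-1 * (\sum_(0 <= j < M) cos (i%:R * (j%:R * theta)) -
   \sum_(0 <= j < M) cos (i.+2%:R * (j%:R * theta)))).
  rewrite -sumrB [2 / _]mulrC -mulrA mulr_sumr.
  congr (_ * _); apply: eq_bigr => j _; set x := j%:R * theta.
  have -> : i%:R * x = i.+1%:R * x - x by rewrite -natr1; ring.
  have -> : i.+2%:R * x = i.+1%:R * x + x by rewrite -[i.+2%:R]natr1; ring.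
  by rewrite cosB cosD expr0; ring.
rewrite [X in _ - X]sum_cos //= negbK.
case: i iM => [|i] iM; last first.
  by rewrite sum_cos ?subrr ?mulr0 //; lia.
rewrite (eq_bigr (fun=> 1)) => [|j _]; last by rewrite mul0r cos0.
by rewrite big_const_nat subn0 iter_addr_0 subr0 mulVf.
Qed.

(** The eigenvector identity sin(ax - x) + sin(ax + x) = 2 cos x sin(ax), at a = i + 2. *)
Lemma sine_sumS p i : sine_sum p.+1 i.+1 = sine_sum p i + sine_sum p i.+2.
Proof.
rewrite /sine_sum -mulrDr -big_split /=; congr (_ * _); apply: eq_bigr => j _.
set x := j%:R * theta.
have -> : i.+1%:R * x = i.+2%:R * x - x by rewrite -[i.+2%:R]natr1; ring.
have -> : i.+3%:R * x = i.+2%:R * x + x by rewrite -[i.+3%:R]natr1; ring.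
by rewrite sinB sinD exprS; ring.
Qed.

Lemma sine_sumS0 p : sine_sum p.+1 0 = sine_sum p 1.
Proof.
rewrite /sine_sum; congr (_ * _); apply: eq_bigr => j _.
set x := j%:R * theta.
by have -> : 2%:R * x = x + x by [ring]; rewrite sinD mul1r exprS; ring.
Qed.

Lemma sine_sum_end p i : i.+1 = M -> sine_sum p i = 0.
Proof.
move=> iM; rewrite /sine_sum iM big1 ?mulr0 // => j _.
have -> : M%:R * (j%:R * theta) = j%:R * pi by rewrite /theta; field.
by rewrite sin_natpi mulr0 mul0r.
Qed.

(** The summand is invariant under j -> M - j. It vanishes at j = 0 through the sine and, as [n] is
    positive, at j = M/2 through the cosine. *)
Lemma sine_sum_fold n : (0 < n)%N ->
  sine_sum (2 * n) 0 = M%:R^-1 *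
    \sum_(1 <= j < (M.-1 %/ 2).+1)
      4 ^+ (n + 1) * sin (j%:R * pi / M%:R) ^+ 2 * cos (j%:R * pi / M%:R) ^+ (2 * n).
Proof.
move=> n_gt0.
have fold (f : nat -> R) : f 0%N = 0 -> (forall j, (0 < j < M)%N -> f (M - j)%N = f j) ->
    (forall j, M = j.*2 -> f j = 0) ->
    \sum_(0 <= j < M) f j = 2 * \sum_(1 <= j < (M.-1 %/ 2).+1) f j.
  move=> f0 fM fh; rewrite big_ltn // f0 add0r.
  rewrite (big_cat_nat (n := (M.-1 %/ 2).+1)) //=; last lia.
  rewrite mulrDl mul1r; congr (_ + _).
  set a := (M.-1 %/ 2)%N; have [Ma|Ma] : M = a.*2.+1 \/ M = a.*2.+2 by lia.
    rewrite big_nat_rev -[a.+1 in LHS]addn1 addnC big_addn Ma.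
    rewrite (_ : a.*2.+1 - a = a.+1)%N; last lia.
    by apply: eq_big_nat => i hi; rewrite -fM; [congr f | ]; lia.
  rewrite big_ltn ?fh ?add0r; [|lia|lia].
  rewrite big_nat_rev -[a.+2 in LHS]add1n big_addn Ma.
  rewrite (_ : a.*2.+2 - a.+1 = a.+1)%N; last lia.
  by apply: eq_big_nat => i hi; rewrite -fM; [congr f | ]; lia.
rewrite /sine_sum fold.
- rewrite [2 / _]mulrC -mulrA; congr (_ * _).
  rewrite mulrA mulr_sumr; apply: eq_bigr => j _; rewrite /theta mulrA mul1r.
  set s := sin _; set c := cos _; rewrite exprMn addn1 exprS exprM.
  by have -> : 2 ^+ 2 = 4 :> R by [ring]; ring.
- by rewrite mul0r sin0 !mul0r.
- move=> j jM; rewrite natrB; last lia.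
  have -> : (M%:R - j%:R) * theta = - (j%:R * theta) + pi by rewrite /theta; field.
  rewrite !mul1r sinDpi cosDpi sinN cosN opprK mulrN.
  by rewrite exprM sqrrN -exprM.
- move=> j Mj; have -> : j%:R * theta = pi / 2.
    have : M%:R = 2 * j%:R :> R by rewrite Mj -mul2n natrM.
    have := M_neq0; rewrite /theta => /[swap] ->; rewrite mulf_eq0 negb_or => /andP[_ ?].
    by field.
  by rewrite cos_pihalf mulr0 expr0n muln_eq0 /= (gtn_eqF n_gt0) mulr0.
Qed.

End Sines.

Theorem corollary3p2 (R : realType) :
  (forall h : nat, num_semiorders h 1 = 1%N /\ num_semiorders h 0 = 1%N) /\
  (forall n h : nat, (2 <= n)%N ->
    (num_semiorders h n)%:R =
      (h + 3)%:R^-1 *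
        \sum_(1 <= j < ((h + 2) %/ 2).+1)
          4 ^+ (n + 1) * sin (j%:R * pi / (h + 3)%:R) ^+ 2 *
          cos (j%:R * pi / (h + 3)%:R) ^+ (2 * n) :> R).
Proof.
split=> [h|n h n2]; first by rewrite !num_semiordersE.
pose T := @sine_sum R (h + 3).
have M_gt0 : (0 < h + 3)%N by rewrite addn3.
have T0 i : (i <= h.+2)%N -> T 0 i = (i == 0)%:R.
  by move=> ih; apply: sine_sum0; lia.
have TS p i : (i <= h.+1)%N -> T p.+1 i.+1 = T p i + T p i.+2.
  by move=> _; apply: sine_sumS.
have Tend p : T p h.+2 = 0 by apply: sine_sum_end; lia.
(* The path has vertices 0, ..., h + 1, so [T] must vanish at h + 2; truncating at [(n.*2).+1] just
   keeps degree [n.*2]. *)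
have := @coef_walk R (n.*2).+1 h.+1 T isT T0 (@sine_sumS0 R (h + 3)) TS Tend n.*2 0 (ltnSn _) isT.
rewrite num_semiordersE (@size_down_lists R (n.*2).+1) // !mul1r => ->.
rewrite -mul2n [LHS]sine_sum_fold //; last lia.
by rewrite (_ : (h + 3).-1 = h + 2)%N //; lia.
Qed.
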